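(* Let $D$ be a weighted oriented graph on vertices $x_1,\dots,x_n$ with $V^+\neq\emptyset$ in which all elements of $V^+$ are sinks, and let $G$ be the underlying graph of $D$. Let $I=I(G)$ and $\tilde I=I(D)$ be the edge ideals of $G$ and $D$ in $R=K[x_1,\dots,x_n]$. Let $\Phi:R\to R$ be the $K$-algebra homomorphism with $\Phi(x_j)=x_j$ if $x_j\notin V^+$ and $\Phi(x_j)=x_j^{w(x_j)}$ if $x_j\in V^+$. For an ideal $J\subseteq R$ let $\Phi(J)$ denote the ideal of $R$ generated by the image of $J$ under $\Phi$. Then $$\Phi(I^k)=\tilde I^{\,k}\quad\text{and}\quad \Phi(I^{(k)})=\tilde I^{(k)}\qquad\text{for all }k\ge1.$$
   Context: A weighted oriented graph $D=(V(D),E(D),w)$ consists of a finite simple graph $G$ (the underlying graph) on vertices $V(D)=\{x_1,\dots,x_n\}$, an orientation of each edge of $G$ (the pair $(x_i,x_j)\in E(D)$ denotes the edge directed from $x_i$ to $x_j$), and a weight function $w:V(D)\to\mathbb{N}=\{1,2,\dots\}$. If $x$ is a source (only arrows leaving $x$), one always assumes $w(x)=1$. Set $V^+=\{x\in V(D): w(x)\neq 1\}$. A vertex $x$ is a sink if all edges at $x$ are directed into $x$. Let $R=K[x_1,\dots,x_n]$ with $K$ a field (vertices are identified with variables). The edge ideal of $D$ is $I(D)=(x_ix_j^{w(x_j)} : (x_i,x_j)\in E(D))\subseteq R$, and the edge ideal of $G$ is $I(G)=(x_ix_j:\{x_i,x_j\}\in E(G))\subseteq R$. For a homogeneous ideal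 $I\subset R$, the $m$-th symbolic power is $I^{(m)}=\bigcap_{p\in \mathrm{Ass}(I)}(I^mR_p\cap R)$, the intersection being over all associated primes of $I$. *)

(* Defs.v *)
From HB Require Import structures.
From mathcomp Require Import all_boot all_order all_algebra.
From mathcomp Require Import fraction mpoly.

Set Implicit Arguments.
Unset Strict Implicit.
Unset Printing Implicit Defensive.

Import GRing.Theory.
Local Open Scope ring_scope.

Section Ideals.
Variable R : comNzRingType.
Implicit Types (I J P S : R -> Prop) (f : R).

Definition is_ideal I : Prop :=
  [/\ I 0, forall a b, I a -> I b -> I (a + b) & forall r a, I a -> I (r * a)].

Definition prime_ideal P : Prop :=
  [/\ is_ideal P, ~ P 1 & forall a b, P (a * b) -> P a \/ P b].

Definition ideal_gen S : R -> Prop := fun f =>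
  exists (m : nat) (a s : 'I_m -> R),
    (forall i, S (s i)) /\ f = \sum_(i < m) a i * s i.

Definition idealM I J : R -> Prop :=
  ideal_gen (fun f => exists a b, [/\ I a, J b & f = a * b]).

Fixpoint idealX I (k : nat) : R -> Prop :=
  if k is k'.+1 then idealM I (idealX I k') else fun=> True.

Definition eq_ideal I J : Prop := forall f, I f <-> J f.

(* P is an associated prime of R / I: P is prime and P = (I : f) for some f. *)
Definition associated_prime I P : Prop :=
  prime_ideal P /\ exists f, forall g, P g <-> I (g * f).

End Ideals.

Section SymbolicPowers.
Variable R : idomainType.
Implicit Types (I J P : R -> Prop) (f : R).

(* Since R is a domain, R_P is the subring of its fraction field consisting   *)
(* of the a / s with s outside the prime ideal P.                             *)
Definition in_localization P (z : {fraction R}) : Prop :=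
  exists a s : R, ~ P s /\ z = tofrac a / tofrac s.

(* J R_P, the ideal of R_P generated by J. *)
Definition localized_ideal P J (z : {fraction R}) : Prop :=
  exists (m : nat) (r : 'I_m -> {fraction R}) (g : 'I_m -> R),
    [/\ forall i, in_localization P (r i), forall i, J (g i)
      & z = \sum_(i < m) r i * tofrac (g i)].

Definition symbolic_power I (m : nat) : R -> Prop := fun f =>
  forall P, associated_prime I P -> localized_ideal P (idealX I m) (tofrac f).

End SymbolicPowers.

Record simple_graph (n : nat) := SimpleGraph {
  adj : rel 'I_n;
  adj_sym : forall i j, adj i j = adj j i;
  adj_irr : irreflexive adj
}.

(* An isolated vertex counts both as a source and as a sink. *)
Definition is_source n (dedge : rel 'I_n) (i : 'I_n) : Prop :=
  forall j, ~~ dedge j i.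

Definition is_sink n (dedge : rel 'I_n) (i : 'I_n) : Prop :=
  forall j, ~~ dedge i j.

(* dedge i j: the edge {i, j} is directed from i to j. *)
Record wograph (n : nat) := WOGraph {
  ugraph : simple_graph n;
  dedge : rel 'I_n;
  weight : 'I_n -> nat;
  dedge_adj : forall i j, adj ugraph i j = dedge i j || dedge j i;
  dedge_asym : forall i j, dedge i j -> ~~ dedge j i;
  weight_gt0 : forall i, (0 < weight i)%N;
  weight_source : forall i, is_source dedge i -> weight i = 1%N
}.

Definition Vplus n (D : wograph n) : {set 'I_n} :=
  [set i | weight D i != 1%N].

Section EdgeIdeals.
Variables (K : fieldType) (n : nat).

Definition graph_edge_ideal (G : simple_graph n) : {mpoly K[n]} -> Prop :=
  ideal_gen (fun f => exists i j, adj G i j /\ f = 'X_i * 'X_j).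

Definition wo_edge_ideal (D : wograph n) : {mpoly K[n]} -> Prop :=
  ideal_gen (fun f => exists i j, dedge D i j /\ f = 'X_i * 'X_j ^+ weight D j).

Definition Phi (D : wograph n) (f : {mpoly K[n]}) : {mpoly K[n]} :=
  f \mPo [tuple if j \in Vplus D then 'X_j ^+ weight D j else 'X_j | j < n].

Definition Phi_ideal (D : wograph n) (J : {mpoly K[n]} -> Prop) :
    {mpoly K[n]} -> Prop :=
  ideal_gen (fun g => exists f, J f /\ g = Phi D f).

End EdgeIdeals.

(* Main.v *)
Require Import Defs.
From HB Require Import structures.
From mathcomp Require Import all_boot all_order all_algebra.
From mathcomp Require Import fraction mpoly.
From Stdlib Require Import Classical.

(* Let w be the weight function and Phi the substitution x_i -> x_i ^ w_i.     *)
(* Since the vertices of weight > 1 are sinks, I(D) is the extension of I(G)   *)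
(* along Phi, and R is free over Phi(R) on the monomials 'X^b with b_i < w_i,  *)
(* so membership in an extended ideal is tested on coordinates.                *)
(* - If P = (I(D) : g) is prime, its contraction along Phi is the intersection *)
(*   of the (I(G) : g_b) over the finitely many nonzero coordinates g_b of g;  *)
(*   being prime it is one of them. Hence Ass(I(D)) contracts into Ass(I(G)),  *)
(*   which gives Phi(I^(k)) <= I(D)^(k).                                       *)
(* - I(G) is the intersection of the primes P_C = (x_i : i in C), C a vertex   *)
(*   cover. So an associated prime of I(G) is some P_C, and h P_C <= I(G) for  *)
(*   some h outside P_C. P_C is also associated to I(D). The ideal             *)
(*   (x_i ^ w_i : i in C) ^ k is P_C-primary and contains I(D)^k, so an f in   *)
(*   I(D)^(k) lies in it; hence the coordinates of f lie in P_C^k, and h^k     *)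
(*   sends them into I(G)^k.                                                   *)

Set Implicit Arguments.
Unset Strict Implicit.
Unset Printing Implicit Defensive.

Import GRing.Theory.
Local Open Scope ring_scope.

(** The ring is free over the image of the substitution, so membership in an extended ideal splits
    into one condition per coordinate ([extended_idealP]), and extension commutes with ordinary
    powers ([extension_idealX]). For symbolic powers one compares associated primes together with
    multipliers outside them: primes of I(D) contract to primes of I(G)
    ([associated_prime_contraction]), and each prime P_C of I(G) is again associated to I(D)
    ([associated_prime_extension]). The multiplier t obtained at P_C over I(D) need not come from
    the image of the substitution; [cover_filt_primary] cancels it, and [cover_filt_idealX] replaces
    it by h^k, which serves all coordinates at once. *)

Section IdealTheory.
Variable R : comNzRingType.
Implicit Types (I J P S : R -> Prop) (f : R).

Lemma ideal_sum I (T : Type) (r : seq T) (p : pred T) (F : T -> R) :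
  is_ideal I -> (forall i, p i -> I (F i)) -> I (\sum_(i <- r | p i) F i).
Proof. by case=> I0 ID _ IF; apply: big_ind. Qed.

Lemma ideal_gen_ideal S : is_ideal (ideal_gen S).
Proof.
split.
- by exists 0%N, (fun=> 0), (fun=> 0); split; [case | rewrite big_ord0].
- move=> _ _ [m1 [a1 [s1 [S1 ->]]]] [m2 [a2 [s2 [S2 ->]]]].
  exists (m1 + m2)%N.
  exists (fun i => match split i with inl j => a1 j | inr j => a2 j end).
  exists (fun i => match split i with inl j => s1 j | inr j => s2 j end).
  split; first by move=> i; case: (split i).
  rewrite big_split_ord; congr (_ + _); apply: eq_bigr => i _.
    by rewrite (unsplitK (inl i)).
  by rewrite (unsplitK (inr i)).
- move=> r _ [m [a [s [Ss ->]]]]; exists m, (fun i => r * a i), s; split=> //.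
  by rewrite mulr_sumr; apply: eq_bigr => i _; rewrite mulrA.
Qed.

Lemma mem_ideal_gen S f : S f -> ideal_gen S f.
Proof.
by move=> Sf; exists 1%N, (fun=> 1), (fun=> f); rewrite big_ord1 mul1r.
Qed.

Lemma ideal_gen_min S I f :
  is_ideal I -> (forall g, S g -> I g) -> ideal_gen S f -> I f.
Proof.
by move=> idI SI [m [a [s [Ss ->]]]]; apply: ideal_sum => // i _; case: idI; auto.
Qed.

Lemma idealX_ideal I k : is_ideal (idealX I k).
Proof. by case: k => [|k]; [split | exact: ideal_gen_ideal]. Qed.

Lemma mem_idealM I J a b : I a -> J b -> idealM I J (a * b).
Proof. by move=> Ia Jb; apply: mem_ideal_gen; exists a, b. Qed.

Lemma colon_ideal I a : is_ideal I -> is_ideal (fun f => I (a * f)).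
Proof.
case=> I0 ID IM; split; first by rewrite mulr0.
- by move=> x y Ix Iy; rewrite mulrDr; apply: ID.
- by move=> r x Ix; rewrite mulrCA; apply: IM.
Qed.

Lemma preim_ideal (R' : comNzRingType) (phi : {rmorphism R' -> R}) I :
  is_ideal I -> is_ideal (fun x => I (phi x)).
Proof.
case=> I0 ID IM; split; first by rewrite rmorph0.
- by move=> x y Ix Iy; rewrite rmorphD; apply: ID.
- by move=> r x Ix; rewrite rmorphM; apply: IM.
Qed.

Lemma prime_idealX P s k : prime_ideal P -> ~ P s -> ~ P (s ^+ k).
Proof.
move=> [_ P1 PM] Ps; elim: k => [|k IHk]; first by rewrite expr0.
by rewrite exprS => /PM[].
Qed.

(** If y lies in the first ideal but not in P, then y * f is in the whole intersection for every f
    in the remaining one, so f is in P. The empty intersection is the whole ring, which P cannot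
    contain. *)
Lemma prime_ideal_bigcap P (T : eqType) (s : seq T) (J : T -> R -> Prop) :
  prime_ideal P -> (forall i, is_ideal (J i)) ->
  (forall f, (forall i, i \in s -> J i f) -> P f) ->
  exists2 i, i \in s & forall f, J i f -> P f.
Proof.
move=> [idP P1 PM] idJ; elim: s => [|i s IHs] sP.
  by case: P1; apply: sP.
have [JP | nJP] := classic (forall f, J i f -> P f).
  by exists i; rewrite ?mem_head.
have [y nJPy] := not_all_ex_not _ _ nJP; have [Jy Py] := imply_to_and _ _ nJPy.
have [f sf|j js JP] := IHs; last by exists j; rewrite // inE js orbT.
have /PM[] // : P (y * f); apply: sP => j.
rewrite inE => /predU1P[->|js].
  by rewrite mulrC; case: (idJ i) => _ _; apply.
by case: (idJ j) => _ _; apply; apply: sf.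
Qed.

End IdealTheory.

(** * Symbolic powers without fractions *)

Section Localization.
Variable R : idomainType.
Implicit Types (I J P : R -> Prop) (f : R).

Lemma localized_idealP P J f : prime_ideal P -> is_ideal J ->
  localized_ideal P J (tofrac f) <-> exists2 s, ~ P s & J (s * f).
Proof.
move=> [idP P1 PM] idJ; split=> [[m [r [g [rP gJ fE]]]] | [s Ps Jsf]].
  have tofracK s : ~ P s -> tofrac s != 0.
    by move=> Ps; rewrite tofrac_eq0; apply/eqP => s0; case: Ps; rewrite s0; case: idP.
  (* A partial sum need not come from R, so the induction only claims that some multiple of it
     does. *)
  suff [s Ps [y Jy yE]] : exists2 s, ~ P s &
      exists2 y, J y & tofrac s * (\sum_(i < m) r i * tofrac (g i)) = tofrac y.
    exists s => //; suff -> : s * f = y by [].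
    by apply/eqP; rewrite -tofrac_eq tofracM fE yE.
  elim: m r g rP gJ {fE} => [|m IHm] r g rP gJ.
    by exists 1 => //; exists 0; [case: idJ | rewrite big_ord0 mulr0 tofrac0].
  have [||s Ps [y Jy yE]] := IHm (r \o lift ord0) (g \o lift ord0).
  - by move=> i; apply: rP.
  - by move=> i; apply: gJ.
  have [a [s' [Ps' rE]]] := rP ord0.
  exists (s' * s); first by case/PM.
  exists (s * a * g ord0 + s' * y).
    by case: idJ => _ JD JM; apply: JD; apply: JM.
  rewrite big_ord_recl mulrDr tofracD; congr (_ + _).
    rewrite rE !tofracM mulrA; congr (_ * _).
    by rewrite (mulrC (tofrac s')) -mulrA [X in _ * X]mulrC divfK // tofracK.
  by rewrite !tofracM -mulrA -yE.
have s0 : tofrac s != 0.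
  by rewrite tofrac_eq0; apply/eqP => s0; case: Ps; rewrite s0; case: idP.
exists 1%N, (fun=> (tofrac s)^-1), (fun=> s * f); split=> // [_|].
  by exists 1, s; rewrite tofrac1 mul1r.
by rewrite big_ord1 tofracM mulKf.
Qed.

Lemma associated_prime_prime I P : associated_prime I P -> prime_ideal P.
Proof. by case. Qed.

Lemma symbolic_powerP I m f :
  symbolic_power I m f <->
  forall P, associated_prime I P -> exists2 s, ~ P s & idealX I m (s * f).
Proof.
by split=> sf P PI; have := sf P PI;
  have := localized_idealP f (associated_prime_prime PI) (idealX_ideal I m); tauto.
Qed.

Lemma symbolic_power_ideal I m : is_ideal (symbolic_power I m).
Proof.
have id := idealX_ideal I m; split.
- apply/symbolic_powerP => P [[_ P1 _] _]; exists 1 => //.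
  by rewrite mulr0; case: id.
- move=> a b /symbolic_powerP Ia /symbolic_powerP Ib; apply/symbolic_powerP.
  move=> P PI; have [s Ps Is] := Ia P PI; have [t Pt It] := Ib P PI.
  exists (s * t); first by case: PI => -[_ _ PM] _ /PM[].
  case: id => _ ID IM; rewrite mulrDr; apply: ID; last by rewrite -mulrA; apply: IM.
  by rewrite mulrAC mulrC; apply: IM.
- move=> r a /symbolic_powerP Ia; apply/symbolic_powerP => P PI.
  have [s Ps Is] := Ia P PI; exists s => //.
  by rewrite mulrCA; case: id => _ _; apply.
Qed.

End Localization.

Section MonomialPushforward.
Variables (R : comNzRingType) (n : nat).
Implicit Types (f : {mpoly R[n]}) (p : pred 'X_{1..n}) (g : 'X_{1..n} -> 'X_{1..n}).

(** Among the exponents satisfying [p], only [c] is sent to [u], so no two terms collide there. This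
    serves both restriction to a set of exponents and [pow_coef]. *)
Lemma mcoeff_pushforward f p g c u :
  p c -> (forall m, p m -> (g m == u) = (m == c)) ->
  (\sum_(m <- msupp f | p m) f@_m *: 'X_[g m])@_u = f@_c.
Proof.
move=> pc gE; rewrite raddf_sum /= (eq_bigr (fun m => f@_m * (m == c)%:R)).
  have [cf | cf] := boolP (c \in msupp f).
    rewrite big_mkcond (bigD1_seq c) ?msupp_uniq //= pc eqxx mulr1 big1 ?addr0 //.
    by move=> m /negPf ->; rewrite mulr0 if_same.
  rewrite big_seq_cond big1 ?(memN_msupp_eq0 cf) // => m /andP[mf _].
  by case: eqP mf cf => [-> -> //|]; rewrite mulr0.
by move=> m pm; rewrite mcoeffZ mcoeffX gE.
Qed.

Definition mrestr p f := \sum_(m <- msupp f | p m) f@_m *: 'X_[m].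

Lemma mcoeff_mrestr p f m : (mrestr p f)@_m = if p m then f@_m else 0.
Proof.
case: ifPn => pm; first by rewrite (@mcoeff_pushforward _ _ id m).
rewrite raddf_sum big1 //= => c pc; rewrite mcoeffZ mcoeffX.
by case: eqP pc pm => [-> -> //|]; rewrite mulr0.
Qed.

End MonomialPushforward.

(** * Coordinates over the subring of powers *)

Section PowerSubstitution.
Variables (R : comNzRingType) (n : nat) (w : 'I_n -> nat).
Hypothesis w_gt0 : forall i, (0 < w i)%N.
Implicit Types (f g h : {mpoly R[n]}) (m r u b : 'X_{1..n}).

Definition mnm_scale m := [multinom (w i * m i)%N | i < n].
Definition mnm_div m := [multinom (m i %/ w i)%N | i < n].
Definition mnm_mod m := [multinom (m i %% w i)%N | i < n].

Definition var_powers : n.-tuple {mpoly R[n]} := [tuple 'X_i ^+ w i | i < n].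

(* 'X^b with b = mnm_mod r run through a basis of R[x] over the subring        *)
(* R[x_i ^ w_i]; pow_coef r f is the preimage under the substitution           *)
(* x_i -> x_i ^ w_i of the coordinate of f along that basis vector.            *)
Definition pow_coef r f :=
  \sum_(m <- msupp f | mnm_mod m == mnm_mod r) f@_m *: 'X_[mnm_div m].

Lemma mnm_divE m : m = (mnm_scale (mnm_div m) + mnm_mod m)%MM.
Proof. by apply/mnmP => i; rewrite !mnmE mulnC -divn_eq. Qed.

Lemma mnm_div_scaleD u m : mnm_div (mnm_scale u + m) = (u + mnm_div m)%MM.
Proof. by apply/mnmP => i; rewrite !mnmE mulnC divnMDl. Qed.

Lemma mnm_mod_scaleD u m : mnm_mod (mnm_scale u + m) = mnm_mod m.
Proof. by apply/mnmP => i; rewrite !mnmE mulnC modnMDl. Qed.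

Lemma mnm_mod_mod m : mnm_mod (mnm_mod m) = mnm_mod m.
Proof. by apply/mnmP => i; rewrite !mnmE modn_mod. Qed.

Lemma mnm_div_mod m : mnm_div (mnm_mod m) = 0%MM.
Proof. by apply/mnmP => i; rewrite !mnmE divn_small // ltn_pmod. Qed.

Lemma comp_var_powersX m : 'X_[m] \mPo var_powers = 'X_[mnm_scale m].
Proof.
rewrite comp_mpolyX mpolyXE_id; apply: eq_bigr => i _.
by rewrite tnth_mktuple mnmE exprM.
Qed.

Lemma mcoeff_pow_coef r f u :
  (pow_coef r f)@_u = f@_(mnm_scale u + mnm_mod r).
Proof.
apply: mcoeff_pushforward => [|m /eqP rE].
  by rewrite mnm_mod_scaleD mnm_mod_mod.
apply/eqP/eqP => [<-|->]; first by rewrite -rE -mnm_divE.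
by rewrite mnm_div_scaleD mnm_div_mod addm0.
Qed.

Lemma pow_coef_is_additive r : zmod_morphism (pow_coef r).
Proof. by move=> f g; apply/mpolyP => u; rewrite mcoeffB !mcoeff_pow_coef mcoeffB. Qed.

HB.instance Definition _ r :=
  GRing.isZmodMorphism.Build {mpoly R[n]} {mpoly R[n]} (pow_coef r)
    (pow_coef_is_additive r).

Lemma pow_coefZ r a f : pow_coef r (a *: f) = a *: pow_coef r f.
Proof. by apply/mpolyP => u; rewrite mcoeffZ !mcoeff_pow_coef mcoeffZ. Qed.

Lemma pow_coefX r m :
  pow_coef r 'X_[m] = if mnm_mod m == mnm_mod r then 'X_[mnm_div m] else 0.
Proof. by rewrite /pow_coef msuppX big_mkcond big_seq1 mcoeffX eqxx scale1r. Qed.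

(** On monomials, multiplying by a scaled exponent shifts the quotients and leaves the residues
    unchanged. *)
Lemma pow_coefM r g f : pow_coef r ((g \mPo var_powers) * f) = g * pow_coef r f.
Proof.
rewrite [in LHS](mpolyE f) [in RHS](mpolyE f) !raddf_sum !mulr_sumr raddf_sum.
apply: eq_bigr => m _ /=.
rewrite -scalerAr !pow_coefZ -scalerAr; congr (_ *: _).
rewrite [in LHS](mpolyE g) [in RHS](mpolyE g) raddf_sum !mulr_suml raddf_sum.
apply: eq_bigr => u _ /=.
rewrite comp_mpolyZ -!scalerAl pow_coefZ; congr (_ *: _).
rewrite comp_var_powersX -mpolyXD !pow_coefX mnm_mod_scaleD mnm_div_scaleD.
by case: ifP; rewrite ?mulr0 // mpolyXD.
Qed.

Lemma pow_coef_decomp f :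
  f = \sum_(b <- undup (map mnm_mod (msupp f))) 'X_[b] * (pow_coef b f \mPo var_powers).
Proof.
rewrite [LHS]mpolyE.
transitivity (\sum_(b <- undup (map mnm_mod (msupp f)))
    \sum_(m <- msupp f | mnm_mod m == mnm_mod b) f@_m *: 'X_[m]).
  rewrite (exchange_big_dep xpredT) //= big_seq [RHS]big_seq; apply: eq_bigr => m mf.
  have mb : mnm_mod m \in undup (map mnm_mod (msupp f)).
    by rewrite mem_undup map_f.
  rewrite big_mkcond (bigD1_seq (mnm_mod m)) ?undup_uniq //= mnm_mod_mod eqxx.
  rewrite big_seq_cond big1 ?addr0 // => b /andP[]; rewrite mem_undup.
  by move=> /mapP[c _ ->]; rewrite mnm_mod_mod eq_sym => /negPf ->.
rewrite big_seq [RHS]big_seq; apply: eq_bigr => b; rewrite mem_undup.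
case/mapP => c _ ->; rewrite raddf_sum mulr_sumr mnm_mod_mod.
apply: eq_bigr => m /eqP <-.
by rewrite /= comp_mpolyZ -scalerAr comp_var_powersX -mpolyXD addmC -mnm_divE.
Qed.

Definition extended_ideal (J : {mpoly R[n]} -> Prop) :=
  ideal_gen (fun g => exists f, J f /\ g = f \mPo var_powers).

Lemma extended_idealP (J : {mpoly R[n]} -> Prop) f : is_ideal J ->
  extended_ideal J f <-> forall r, J (pow_coef r f).
Proof.
move=> idJ; split=> [Jf r | Jf].
  apply: (@ideal_gen_min _ _ (fun f => forall r, J (pow_coef r f)) _ _ _ Jf).
    have [J0 JD JM] := idJ; split=> [s|a b Ja Jb s|a b Jb s].
    - by rewrite raddf0; apply: J0.
    - by rewrite raddfD; apply: JD; [apply: Ja | apply: Jb].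
    (* Each coordinate of [a * b] is a combination of the coordinates of [b], by linearity over the
       subring. *)
    - rewrite (pow_coef_decomp b) mulr_sumr raddf_sum; apply: ideal_sum => // c _.
      by rewrite /= mulrA mulrC pow_coefM mulrC; apply: JM; apply: Jb.
  move=> _ [g [Jg ->]] s; rewrite -[_ \mPo _]mulr1 pow_coefM mulrC.
  by case: idJ => _ _; apply.
have idE : is_ideal (extended_ideal J) := ideal_gen_ideal _.
have [_ _ EM] := idE; rewrite (pow_coef_decomp f); apply: ideal_sum => // b _.
by apply: EM; apply: mem_ideal_gen; exists (pow_coef b f).
Qed.

End PowerSubstitution.

(** * Monomial filtrations attached to sets of vertices *)

Section CoverFiltration.
Variables (R : idomainType) (n : nat).
Implicit Types (f g t : {mpoly R[n]}) (m u : 'X_{1..n}) (w : 'I_n -> nat).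
Implicit Types (C : {set 'I_n}) (k d : nat).

(** For positive weights, the largest k such that 'X^m lies in (x_i ^ w_i : i in C) ^ k. *)
Definition floor_deg C w m := (\sum_(i in C) m i %/ w i)%N.

(* The monomial ideal (x_i ^ w_i : i in C) ^ k.                                *)
Definition cover_filt C w k f := forall m, f@_m != 0 -> (k <= floor_deg C w m)%N.

Definition unit_weight : 'I_n -> nat := fun=> 1%N.

(* The prime ideal (x_i : i in C).                                             *)
Definition cover_prime C := cover_filt C unit_weight 1.

Lemma floor_degD C w m u : (floor_deg C w m + floor_deg C w u <= floor_deg C w (m + u))%N.
Proof.
rewrite -big_split; apply: leq_sum => i _; rewrite mnmDE; have [->|wi] := posnP (w i).
  by rewrite !divn0.
by rewrite divnD ?leq_addr.
Qed.

Lemma floor_deg1D C m u :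
  floor_deg C unit_weight (m + u) =
    (floor_deg C unit_weight m + floor_deg C unit_weight u)%N.
Proof.
by rewrite -big_split; apply: eq_bigr => i _; rewrite mnmDE !divn1.
Qed.

Lemma floor_deg_scale C w m r : (forall i, 0 < w i)%N ->
  floor_deg C w (mnm_scale w m + mnm_mod w r) = floor_deg C unit_weight m.
Proof.
move=> w_gt0; apply: eq_bigr => i _.
by rewrite !mnmE mulnC divnMDl // divn_small ?ltn_pmod // addn0 divn1.
Qed.

Lemma floor_deg_div C w m : floor_deg C unit_weight (mnm_div w m) = floor_deg C w m.
Proof. by apply: eq_bigr => i _; rewrite mnmE divn1. Qed.

Lemma floor_deg1_gt0 C m :
  (0 < floor_deg C unit_weight m)%N -> exists2 i, i \in C & (0 < m i)%N.
Proof.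
rewrite lt0n sum_nat_eq0 negb_forall_in => /exists_inP[i iC].
by rewrite divn1 -lt0n; exists i.
Qed.

Lemma mcoeffM_neq0 f g m : (f * g)@_m != 0 ->
  exists u v, [/\ f@_u != 0, g@_v != 0 & m = (u + v)%MM].
Proof.
rewrite -mcoeff_msupp => /msuppM_le/allpairsP[[u v] /= [fu gv ->]].
by exists u, v; rewrite -!mcoeff_msupp.
Qed.

Lemma cover_filtM C w j k f g :
  cover_filt C w j f -> cover_filt C w k g -> cover_filt C w (j + k) (f * g).
Proof.
move=> fj gk m /mcoeffM_neq0[u [v [/fj ju /gk kv ->]]].
by apply: leq_trans (floor_degD _ _ _ _); apply: leq_add.
Qed.

Lemma cover_filt_ideal C w k : is_ideal (cover_filt C w k).
Proof.
split=> [m|f g fk gk m|r f fk]; first by rewrite mcoeff0 eqxx.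
- rewrite mcoeffD; have [-> | /fk //] := eqVneq (f@_m) 0.
  by rewrite add0r; apply: gk.
- by rewrite -[k]add0n; apply: cover_filtM.
Qed.

Lemma cover_filt_pow_coef C w k f : (forall i, 0 < w i)%N ->
  cover_filt C w k f <-> forall r, cover_filt C unit_weight k (pow_coef w r f).
Proof.
move=> w_gt0; split=> [fk r m | fk m fm].
  by rewrite mcoeff_pow_coef // => /fk; rewrite floor_deg_scale.
rewrite -floor_deg_div; apply: (fk m).
by rewrite mcoeff_pow_coef // -mnm_divE.
Qed.

(* Compare the components of lowest degree in the variables of C: that of t    *)
(* has degree 0, and no carry occurs in floor_deg when multiplying by it.      *)
Lemma cover_filt_primary C w k t f :
  ~ cover_prime C t -> cover_filt C w k (t * f) -> cover_filt C w k f.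
Proof.
move=> tC tfk; pose cdeg := floor_deg C unit_weight.
suff low d m : cdeg m = d -> (floor_deg C w m < k)%N -> f@_m = 0.
  move=> m fm; rewrite leqNgt; apply/negP => /(low _ _ erefl) fm0.
  by rewrite fm0 eqxx in fm.
elim/ltn_ind: d m => d IHd.
pose bad m := (floor_deg C w m < k)%N && (cdeg m == d).
pose t0 := mrestr (fun m => cdeg m == 0%N) t.
have t0_neq0 : t0 != 0.
  apply/eqP => t00; case: tC => m tm; rewrite lt0n; apply: contraNneq tm => m0.
  have := congr1 (mcoeff m) t00.
  by rewrite mcoeff_mrestr mcoeff0 /cdeg m0 eqxx => ->.
suff f0 : mrestr bad f = 0.
  move=> m md mk; have := congr1 (mcoeff m) f0.
  by rewrite mcoeff_mrestr mcoeff0 /bad md mk eqxx.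
have floor0 u v : cdeg u = 0%N -> floor_deg C w (u + v) = floor_deg C w v.
  move/eqP; rewrite /cdeg sum_nat_eq0 => /forall_inP u0.
  by apply: eq_bigr => i /u0; rewrite divn1 mnmDE => /eqP ->.
(* At a bad exponent, the terms of [t] of positive degree in C meet only coefficients of [f] of
   lower degree, which vanish by induction. So this product is the bad part of [t * f], which is
   zero by hypothesis. *)
have /eqP : t0 * mrestr bad f = 0.
  transitivity (mrestr bad (t * f)).
    apply/mpolyP => m; rewrite mcoeff_mrestr !mcoeffM.
    have [mbad | mNbad] := boolP (bad m); last first.
      rewrite big1 // => -[bu bv] /=.
      move: (val bu) (val bv) => u v /eqP mE; rewrite !mcoeff_mrestr.
      case: eqP => [u0|]; last by rewrite mul0r.
      move: mNbad; rewrite /bad mE floor0 // /cdeg floor_deg1D -/cdeg u0 add0n.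
      by move=> /negPf ->; rewrite mulr0.
    apply: eq_bigr => -[bu bv] /=.
    move: (val bu) (val bv) => u v /eqP mE; rewrite !mcoeff_mrestr.
    have /andP[mk /eqP md] := mbad.
    have mdE : (cdeg u + cdeg v = d)%N by rewrite -md mE /cdeg floor_deg1D.
    case: eqP => [u0 | /eqP u0].
      by rewrite /bad -(floor0 u) // -mE mk -mdE u0 add0n eqxx.
    rewrite mul0r (IHd (cdeg v)) ?mulr0 // -?mdE.
      by rewrite -[ltnLHS]add0n ltn_add2r lt0n.
    apply: leq_ltn_trans mk; rewrite mE.
    by apply: leq_trans (floor_degD _ _ _ _); rewrite leq_addl.
  apply/mpolyP => m; rewrite mcoeff_mrestr mcoeff0.
  case: ifP => // /andP[mk _]; apply/eqP; apply: contraLR mk => /tfk.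
  by rewrite -leqNgt.
by rewrite mulf_eq0 (negPf t0_neq0) => /eqP.
Qed.

(** Primality is [cover_filt_primary] with unit weights and k = 1. *)
Lemma cover_prime_prime C : prime_ideal (cover_prime C).
Proof.
split; first exact: cover_filt_ideal.
- move=> /(_ 0%MM); rewrite mcoeff1 eqxx oner_eq0 => /(_ isT).
  by rewrite /floor_deg big1 // => i _; rewrite mnm0E div0n.
- move=> a b ab; have [|na] := classic (cover_prime C a); first by left.
  by right; apply: cover_filt_primary ab.
Qed.

Lemma cover_primeX C i : i \in C -> cover_prime C 'X_i.
Proof.
move=> iC m; rewrite mcoeffX; have [<- _|_] := eqVneq U_(i)%MM m; last by rewrite eqxx.
by rewrite /floor_deg (bigD1 i) //= divn1 mnm1E eqxx.
Qed.

(* The exponent of the socle generator of R[x_i : i in C] / (x_i ^ w_i).       *)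
Definition socle_mnm C w := [multinom if i \in C then (w i).-1 else 0%N | i < n].

(** A monomial free of the variables of C keeps exponents w_i - 1 on C after the multiplication,
    just short of every generator. *)
Lemma cover_prime_socle C w g : (forall i, 0 < w i)%N ->
  cover_filt C w 1 (g * 'X_[socle_mnm C w]) -> cover_prime C g.
Proof.
move=> w_gt0 gC m; rewrite -(mcoeffMX g (socle_mnm C w)) => /gC.
rewrite !lt0n; apply: contraNneq => /eqP; rewrite sum_nat_eq0 => /forall_inP m0.
rewrite /floor_deg big1 // => i iC; have := m0 i iC.
rewrite divn1 mnmDE mnmE iC => /eqP ->.
by rewrite addn0 divn_small // prednK.
Qed.

Lemma idealX_cover_filt C w (I : {mpoly R[n]} -> Prop) k f :
  (forall g, I g -> cover_filt C w 1 g) -> idealX I k f -> cover_filt C w k f.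
Proof.
move=> IC; elim: k f => [|k IHk] f //= If.
apply: (ideal_gen_min (cover_filt_ideal C w k.+1) _ If) => _ [a [b [/IC aC /IHk bC ->]]].
by rewrite -add1n; apply: cover_filtM.
Qed.

(* Every monomial of the k-th filtration step is a product of k variables in C *)
(* and a cofactor, and each of these variables is moved into I by one h.       *)
Lemma cover_filt_idealX C (I : {mpoly R[n]} -> Prop) h k f : is_ideal I ->
  (forall i, i \in C -> I ('X_i * h)) ->
  cover_filt C unit_weight k f -> idealX I k (h ^+ k * f).
Proof.
move=> idI Ih; have idX j := idealX_ideal I j.
have XM m : (k <= floor_deg C unit_weight m)%N -> idealX I k (h ^+ k * 'X_[m]).
  elim: k m {f} => [|k IHk] m km //.
  have [i iC mi] := floor_deg1_gt0 (leq_trans (ltn0Sn k) km).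
  have mE : m = (U_(i) + (m - U_(i)))%MM.
    apply/mnmP => j; rewrite mnmDE mnmBE mnm1E subnKC //.
    by case: eqP => // <-.
  have -> : h ^+ k.+1 * 'X_[m] = ('X_i * h) * (h ^+ k * 'X_[m - U_(i)]).
    by rewrite {1}mE mpolyXD exprS mulrACA [h * _]mulrC.
  apply: mem_idealM; [exact: Ih | apply: IHk].
  move: km; rewrite {1}mE floor_deg1D.
  suff -> : floor_deg C unit_weight U_(i) = 1%N by rewrite add1n ltnS.
  rewrite /floor_deg (bigD1 i) //= divn1 mnm1E eqxx big1 // => j /andP[_ ji].
  by rewrite divn1 mnm1E eq_sym (negPf ji).
move=> fk; rewrite (mpolyE f) mulr_sumr big_seq; apply: ideal_sum => // m.
rewrite mcoeff_msupp => /fk km; rewrite -scalerAr -mul_mpolyC.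
by case: (idX k) => _ _; apply; apply: XM.
Qed.

End CoverFiltration.

Section IdealExtension.
Variables (R R' : comNzRingType) (phi : {rmorphism R -> R'}).

Lemma extension_idealX (I : R -> Prop) (I' : R' -> Prop) k :
  eq_ideal (ideal_gen (fun g => exists f, I f /\ g = phi f)) I' ->
  eq_ideal (ideal_gen (fun g => exists f, idealX I k f /\ g = phi f)) (idealX I' k).
Proof.
move=> eqI'; elim: k => [|k IHk] g; split=> //.
- move=> _; rewrite -[g]mulr1; have [_ _] := ideal_gen_ideal
    (fun g => exists f, idealX I 0 f /\ g = phi f); apply.
  by apply: mem_ideal_gen; exists 1; rewrite rmorph1.
- apply: ideal_gen_min => [|_ [f [If ->]]]; first exact: idealX_ideal.
  apply: (ideal_gen_min (preim_ideal phi (idealX_ideal _ k.+1)) _ If).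
  move=> _ [a [b [Ia Ib ->]]].
  rewrite rmorphM; apply: mem_idealM.
    by apply/eqI'; apply: mem_ideal_gen; exists a.
  by apply/IHk; apply: mem_ideal_gen; exists b.
apply: ideal_gen_min => [|_ [a [b [/eqI' Ia /IHk Ib ->]]]].
  exact: ideal_gen_ideal.
(* Both factors are mere combinations of images; a colon ideal freezes one while the other is
   reduced to a generator. *)
rewrite mulrC; apply: (ideal_gen_min (colon_ideal b (ideal_gen_ideal _)) _ Ia).
move=> _ [u [Iu ->]]; rewrite mulrC.
apply: (ideal_gen_min (colon_ideal _ (ideal_gen_ideal _)) _ Ib) => _ [v [Iv ->]].
by rewrite -rmorphM; apply: mem_ideal_gen; exists (u * v); split=> //; apply: mem_idealM.
Qed.

Lemma preim_prime P : prime_ideal P -> prime_ideal (fun f => P (phi f)).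
Proof.
move=> [idP P1 PM]; split; first exact: preim_ideal.
  by rewrite rmorph1.
by move=> a b; rewrite rmorphM; apply: PM.
Qed.

End IdealExtension.

Section EdgeIdeals.
Variables (K : fieldType) (n : nat).

(** * Vertex covers and the associated primes of I(G) *)

Section Graph.
Variable G : simple_graph n.
Let I := @graph_edge_ideal K n G.

Definition vertex_cover (C : {set 'I_n}) :=
  [forall i, forall j, adj G i j ==> ((i \in C) || (j \in C))].

Lemma graph_edge_idealP f :
  I f <-> forall C, vertex_cover C -> cover_prime C f.
Proof.
split=> [If C covC | fC].
  have [idP _ _] := cover_prime_prime K C; have [_ _ PM] := idP.
  apply: (ideal_gen_min idP _ If) => _ [i [j [ij ->]]].
  have /orP[iC|jC] := implyP (forallP (forallP covC i) j) ij.
    by rewrite mulrC; apply: PM; apply: cover_primeX.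
  by apply: PM; apply: cover_primeX.
have idI : is_ideal I by exact: ideal_gen_ideal.
have [_ _ IM] := idI.
rewrite (mpolyE f) big_seq; apply: ideal_sum => // m.
rewrite mcoeff_msupp -mul_mpolyC => fm; apply: (IM).
have [[i [j [ij mi mj]]] | noedge] :=
  classic (exists i j, [/\ adj G i j, (0 < m i)%N & (0 < m j)%N]).
  have -> : m = ((m - U_(i) - U_(j)) + (U_(i) + U_(j)))%MM.
    apply/mnmP => l; rewrite !mnmDE !mnmBE !mnm1E -subnDA subnK //.
    case: (i =P l) => [<-|_]; last by case: (j =P l) => [<-|].
    by case: (j =P i) ij => [->|_ _]; rewrite ?adj_irr.
  by rewrite !mpolyXD; apply: IM; apply: mem_ideal_gen; exists i, j.
(* A monomial divisible by no edge has independent support; the complement is a cover whose prime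
   misses the monomial. *)
have covC : vertex_cover [set i | m i == 0%N].
  apply/forallP => i; apply/forallP => j; apply/implyP => ij; rewrite !inE.
  apply/negPn; rewrite negb_or -!lt0n; apply/negP => /andP[mi mj].
  by apply: noedge; exists i, j.
have := fC _ covC m fm; rewrite /floor_deg big1 // => i.
by rewrite inE divn1 => /eqP.
Qed.

(** Q = (I : h) is the intersection of the (P_C : h), hence contains one of them. As Q is proper, h
    is outside that P_C, so (P_C : h) = P_C, and I inside P_C gives Q = P_C. *)
Lemma graph_associated_prime Q : associated_prime I Q ->
  exists C h, [/\ eq_ideal Q (cover_prime C), ~ cover_prime C h
    & forall g, cover_prime C g <-> I (g * h)].
Proof.
move=> [primeQ [h Qh]].
have [||C] := @prime_ideal_bigcap _ Q _ (enum [pred C | vertex_cover C])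
  (fun C f => cover_prime C (h * f)) primeQ.
- by move=> C; exact/colon_ideal/cover_filt_ideal.
- move=> f fC; apply/Qh/graph_edge_idealP => C covC.
  by rewrite mulrC; apply: fC; rewrite mem_enum.
rewrite mem_enum => covC PQ; have [_ Q1 _] := primeQ.
have [[_ _ PM] _ PP] := cover_prime_prime K C.
have hC : ~ cover_prime C h by move=> hC; apply: Q1; apply: PQ; rewrite mulr1.
have QE : eq_ideal Q (cover_prime C).
  move=> g; split=> [/Qh/graph_edge_idealP/(_ C covC)/PP[] // | gC].
  by apply: PQ; apply: PM.
exists C, h; split=> // g.
by split=> [/QE/Qh // | /Qh/QE].
Qed.

End Graph.

(** * Transfer between I(G) and I(D) *)

Section WeightedOrientedGraph.
Variable D : wograph n.
Hypothesis Vplus_sink : forall i, i \in Vplus D -> is_sink (dedge D) i.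
Let w := weight D.
Let w_gt0 : forall i, (0 < w i)%N := weight_gt0 D.
Let I := @graph_edge_ideal K n (ugraph D).
Let I' := @wo_edge_ideal K n D.

Lemma PhiE (f : {mpoly K[n]}) : Phi D f = f \mPo var_powers K w.
Proof.
congr (_ \mPo _); apply: eq_from_tnth => i; rewrite !tnth_mktuple inE.
by rewrite /w; case: eqP => // ->; rewrite expr1.
Qed.

Lemma Phi_idealE (J : {mpoly K[n]} -> Prop) :
  eq_ideal (Phi_ideal D J) (extended_ideal w J).
Proof.
move=> f; split; apply: ideal_gen_min; try exact: ideal_gen_ideal;
  by move=> _ [g [Jg ->]]; apply: mem_ideal_gen; exists g; rewrite PhiE.
Qed.

(** The form in which the sink hypothesis enters: it makes the substitution carry edge generators of
    I(G) to those of I(D). *)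
Lemma weight_tail i j : dedge D i j -> w i = 1%N.
Proof.
move=> ij; apply/eqP; apply/negPn/negP => wi.
have /Vplus_sink/(_ j) : i \in Vplus D by rewrite inE.
by rewrite ij.
Qed.

Lemma comp_var_powersXX i j : dedge D i j ->
  ('X_i * 'X_j) \mPo var_powers K w = 'X_i * 'X_j ^+ w j :> {mpoly K[n]}.
Proof.
move=> ij; rewrite rmorphM /= !comp_mpolyXU -!tnth_nth !tnth_mktuple.
by rewrite (weight_tail ij) expr1.
Qed.

Lemma wo_edge_ideal_extended : eq_ideal (extended_ideal w I) I'.
Proof.
move=> f; split; apply: ideal_gen_min; try exact: ideal_gen_ideal.
  move=> _ [g [Ig ->]].
  have idQ := preim_ideal (comp_mpoly (var_powers K w)) (ideal_gen_ideal _).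
  apply: (ideal_gen_min (idQ _) _ Ig).
  move=> _ [i [j [+ ->]]]; rewrite dedge_adj => /orP[] ij.
    by rewrite /= comp_var_powersXX //; apply: mem_ideal_gen; exists i, j.
  by rewrite /= mulrC comp_var_powersXX //; apply: mem_ideal_gen; exists j, i.
move=> _ [i [j [ij ->]]]; rewrite -comp_var_powersXX //.
apply: mem_ideal_gen; exists ('X_i * 'X_j); split=> //; apply: mem_ideal_gen.
by exists i, j; rewrite dedge_adj ij.
Qed.

Lemma wo_edge_idealX k : eq_ideal (extended_ideal w (idealX I k)) (idealX I' k).
Proof. exact: extension_idealX wo_edge_ideal_extended. Qed.

Lemma wo_edge_idealXP k f : idealX I' k f <-> forall r, idealX I k (pow_coef w r f).
Proof.
have := extended_idealP w_gt0 f (idealX_ideal I k); have := wo_edge_idealX k f; tauto.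
Qed.

Lemma wo_edge_idealP f : I' f <-> forall r, I (pow_coef w r f).
Proof.
have := extended_idealP w_gt0 f (ideal_gen_ideal _ : is_ideal I).
by have := wo_edge_ideal_extended f; tauto.
Qed.

Lemma associated_prime_contraction P : associated_prime I' P ->
  associated_prime I (fun f => P (f \mPo var_powers K w)).
Proof.
move=> [primeP [g Pg]]; pose Q f := P (f \mPo var_powers K w).
have primeQ : prime_ideal Q := preim_prime (comp_mpoly (var_powers K w)) primeP.
have idI : is_ideal I by exact: ideal_gen_ideal.
have [_ _ I'M] : is_ideal I' by exact: ideal_gen_ideal.
split=> //.
pose s := undup (map (mnm_mod w) (msupp g)).
have [b|f sf|b bs bQ] := @prime_ideal_bigcap _ _ _ s
  (fun b f => I (pow_coef w b g * f)) primeQ.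
- exact: colon_ideal.
(* If [f] multiplies every coordinate of [g] into I(G), then its image multiplies [g] into I(D). *)
- apply/Pg; rewrite (pow_coef_decomp w g) mulr_sumr big_seq.
  apply: ideal_sum => [|b /sf Ib]; first exact: ideal_gen_ideal.
  rewrite mulrCA -rmorphM; apply: (I'M); apply/wo_edge_ideal_extended.
  by apply: mem_ideal_gen; exists (f * pow_coef w b g); rewrite mulrC.
exists (pow_coef w b g) => f; split=> [/Pg/wo_edge_idealP/(_ b)|].
  by rewrite pow_coefM.
by rewrite mulrC; apply: bQ.
Qed.

(** The witness is the image of [h] times the socle monomial. A variable x_i with i in C completes
    the socle factor to x_i ^ w_i, giving the image of x_i * h; conversely [cover_prime_socle]
    recovers P_C. *)
Lemma associated_prime_extension C h :
  (forall g, cover_prime C g <-> I (g * h)) ->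
  associated_prime I' (cover_prime C).
Proof.
move=> hC; split; first exact: cover_prime_prime.
have idI : is_ideal I by exact: ideal_gen_ideal.
have [I'0 I'D I'M] : is_ideal I' by exact: ideal_gen_ideal.
pose c := socle_mnm C w.
exists ((h \mPo var_powers K w) * 'X_[c]) => g; split=> [gC | Ig].
  rewrite (mpolyE g) mulr_suml big_seq; apply: ideal_sum => // m.
  rewrite mcoeff_msupp => /gC mC.
  have [i iC mi] := floor_deg1_gt0 mC.
  rewrite -mul_mpolyC -mulrA; apply: (I'M).
  have -> : 'X_[m] * ((h \mPo var_powers K w) * 'X_[c])
     = 'X_[m + c - mnm_scale w U_(i)] * (('X_i * h) \mPo var_powers K w).
    rewrite rmorphM /= comp_var_powersX [RHS]mulrA -mpolyXD submK.
      by rewrite mpolyXD -mulrA [X in _ * X = _]mulrC.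
    apply/mnm_lepP => j; rewrite !mnmE; case: eqP => [<-|_]; last by rewrite muln0.
    by rewrite iC muln1 -(prednK (w_gt0 i)) -add1n leq_add.
  apply: (I'M); apply/wo_edge_ideal_extended/mem_ideal_gen.
  by exists ('X_i * h); split=> //; apply/hC/cover_primeX.
apply: (cover_prime_socle w_gt0); apply/cover_filt_pow_coef => // r.
apply/hC; rewrite mulrC -pow_coefM //.
by move: r; apply/wo_edge_idealP; rewrite mulrCA.
Qed.
End WeightedOrientedGraph.
End EdgeIdeals.

Theorem theorem3p7 (K : fieldType) (n : nat) (D : wograph n)
    (Vplus_neq0 : Vplus D != set0)
    (Vplus_sink : forall i, i \in Vplus D -> is_sink (dedge D) i)
    (k : nat) (k_ge1 : (1 <= k)%N) :
  let I := @graph_edge_ideal K n (ugraph D) in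
  let I' := @wo_edge_ideal K n D in
  eq_ideal (Phi_ideal D (idealX I k)) (idealX I' k) /\
  eq_ideal (Phi_ideal D (symbolic_power I k)) (symbolic_power I' k).
Proof.
move=> I I'; have w_gt0 := weight_gt0 D.
have idI : is_ideal I := ideal_gen_ideal _.
split=> f.
  have := Phi_idealE D (idealX I k) f.
  by have := wo_edge_idealX Vplus_sink k f; tauto.
split=> [|f_sym].
  apply: ideal_gen_min; first exact: symbolic_power_ideal.
  move=> _ [g [/symbolic_powerP g_sym ->]]; apply/symbolic_powerP => P PI'.
  have [s Ps Isg] := g_sym _ (associated_prime_contraction Vplus_sink PI').
  (* [s] avoids the contraction of P, so its image avoids P. *)
  exists (s \mPo var_powers K (weight D)) => //.
  rewrite PhiE -rmorphM; apply/(wo_edge_idealX Vplus_sink).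
  by apply: mem_ideal_gen; exists (s * g).
apply/Phi_idealE/extended_idealP => // [|r]; first exact: symbolic_power_ideal.
apply/symbolic_powerP => Q /graph_associated_prime[C [h [QE Ch hC]]].
have [t Ct I'tf] := (symbolic_powerP _ _ _).1 f_sym _
  (associated_prime_extension Vplus_sink hC).
(* I(D)^k lies in the k-th filtration step, so [t * f] does, and [t], being outside P_C, cancels. *)
have filt_f : cover_filt C (weight D) k f.
  apply: (cover_filt_primary Ct); apply/cover_filt_pow_coef => // r'.
  apply: (idealX_cover_filt (I := I)); last first.
    exact: (wo_edge_idealXP Vplus_sink k (t * f)).1.
  by move=> g Ig; apply/hC; rewrite mulrC; case: idI => _ _; apply.
exists (h ^+ k).
  by move/QE; apply: prime_idealX Ch; apply: cover_prime_prime.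
apply: (@cover_filt_idealX _ _ C) => [//|i iC|]; first exact/hC/cover_primeX.
by move: r; apply/cover_filt_pow_coef.
Qed.
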